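(* Let $G_1=(V_1,b_1,m_1)$ and $G_2=(V_2,b_2,m_2)$ be connected, locally finite weighted graphs with roots (fixed vertices) $o_1\in V_1$, $o_2\in V_2$, and let $k^i_{\pm}$ denote the outer ($+$) and inner ($-$) curvatures of $G_i$ with respect to $o_i$, $i=1,2$. If $$k_+^1(x_1)\ge k_+^2(x_2)\quad\text{and}\quad k_-^1(x_1)\le k_-^2(x_2)$$ for all $x_1\in S_r(o_1)$, all $x_2\in S_r(o_2)$ and all integers $r\ge 0$, then $m_1(S_r(o_1))\ge m_2(S_r(o_2))$ for all integers $r\ge 0$.
   Context: A weighted graph $G=(V,b,m)$ consists of a countable set $V$, a measure $m:V\to(0,\infty)$ (with $m(A)=\sum_{x\in A}m(x)$ for $A\subseteq V$), and a symmetric edge weight $b:V\times V\to[0,\infty)$ vanishing on the diagonal. Write $x\sim y$ if $b(x,y)>0$. The graph is locally finite if every vertex has finitely many neighbors, and connected if any two vertices are joined by a path $x_0\sim x_1\sim\dots\sim x_n$; $d(x,y)$ is the smallest number of edges of a path joining $x$ and $y$. For a fixed vertex $x_0$, $S_r(x_0)=\{x\in V: d(x,x_0)=r\}$. The outer and inner curvatures with respect to $x_0$ at $x\in S_r(x_0)$ are $$k_{\pm}(x)=\frac1{m(x)}\sum_{y\in S_{r\pm1}(x_0)}b(x,y),\qquad k_-(x_0)=0.$$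
   Formalization: The hypothesis m_2(o_2) ≤ m_1(o_1) is added; without it the claim fails at r = 0 (one-vertex graphs with m_1(o_1) = 1, m_2(o_2) = 2, b = 0), and it is exactly the case r = 0 of the conclusion. *)

(* Defs.v *)
From HB Require Import structures.
From mathcomp Require Export all_boot all_order all_algebra.
From mathcomp Require Export boolp classical_sets functions cardinality fsbigop.
From mathcomp Require Export reals constructive_ereal ereal esum.
Set Implicit Arguments.
Unset Strict Implicit.
Unset Printing Implicit Defensive.
Import Order.TTheory GRing.Theory Num.Theory.
Local Open Scope classical_set_scope.
Local Open Scope ring_scope.

Record weighted_graph (R : realType) := WeightedGraph {
  vertex :> countType;
  weight : vertex -> vertex -> R;
  vmeasure : vertex -> R;
  weight_ge0 : forall x y, 0 <= weight x y;
  weight_sym : forall x y, weight x y = weight y x;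
  weight_diag : forall x, weight x x = 0;
  vmeasure_gt0 : forall x, 0 < vmeasure x
}.

Section WeightedGraphTheory.
Variables (R : realType) (G : weighted_graph R).
Implicit Types (x y o : G) (r n : nat) (A : set G).

Definition adj : rel G := fun x y => 0 < weight x y.

Definition locally_finite : Prop := forall x, finite_set [set y | adj x y].

(* In [path adj x p] the vertices are those of [x :: p]: [size p] counts edges. *)
Definition joined_by n x y : Prop :=
  exists p : seq G, [/\ path adj x p, last x p = y & size p = n].

Definition connected : Prop := forall x y, exists n, joined_by n x y.

Lemma joined_byW x y :
  (exists n, joined_by n x y) -> exists n, `[< joined_by n x y >].
Proof. by move=> [n xy]; exists n; apply/asboolP. Qed.

(* The default value 0 is only reached when no path joins x and y, hence never
   in a connected graph. *)
Definition dist x y : nat :=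
  match pselect (exists n, joined_by n x y) with
  | left xy => ex_minn (joined_byW xy)
  | right _ => 0%N
  end.

Definition sphere o r : set G := [set x | dist x o = r].

(* A sum over a set with the convention of [fsbigop] (0 when the support is
   infinite): in a locally finite graph the support of [weight x] is finite, so
   these are the genuine sums. *)
Definition outer_curvature o x : R :=
  (vmeasure x)^-1 * \sum_(y \in sphere o (dist x o).+1) weight x y.

Definition inner_curvature o x : R :=
  if x == o then 0
  else (vmeasure x)^-1 * \sum_(y \in sphere o (dist x o).-1) weight x y.

Definition measure_of A : \bar R := \esum_(x in A) (vmeasure x)%:E.

End WeightedGraphTheory.

Arguments locally_finite {R} G.
Arguments connected {R} G.

(* Main.v *)
(* Write e_i(r) for the total weight of the edges of G_i between S_r and
   S_(r+1).  It equals both the m_i-integral of the outer curvature over S_r and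
   that of the inner curvature over S_(r+1).  Integrating the curvature
   inequalities over S_r(o1) x S_r(o2), resp. over S_(r+1)(o1) x S_(r+1)(o2),
   gives e_2(r) m_1(S_r) <= e_1(r) m_2(S_r) and
   e_1(r) m_2(S_(r+1)) <= e_2(r) m_1(S_(r+1)), hence
   m_1(S_r) m_2(S_(r+1)) <= m_1(S_(r+1)) m_2(S_r) as soon as e_2(r) > 0, and one
   concludes by induction on r. *)
Require Import Defs.
Import Order.TTheory GRing.Theory Num.Theory.
Local Open Scope ring_scope.

Set Implicit Arguments.
Unset Strict Implicit.
Local Open Scope classical_set_scope.

(** Both sides are double sums over [A] and [B], and the terms [w i * v j * f i] and
    [w i * v j * g j] compare one by one. *)
Lemma ler_fsum_cross (R : realFieldType) (I J : choiceType) (A : set I)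
    (B : set J) (w f : I -> R) (v g : J -> R) :
  finite_set A -> finite_set B ->
  (forall i, A i -> 0 <= w i) -> (forall j, B j -> 0 <= v j) ->
  (forall i j, A i -> B j -> f i <= g j) ->
  (\sum_(i \in A) w i * f i) * (\sum_(j \in B) v j) <=
  (\sum_(j \in B) v j * g j) * (\sum_(i \in A) w i).
Proof.
move=> finA finB w0 v0 fg; rewrite [leRHS]mulrC !fsbig_finite// !big_distrlr/=.
rewrite big_seq [leRHS]big_seq; apply: ler_sum => i.
rewrite in_fset_set// inE => Ai.
rewrite big_seq [leRHS]big_seq; apply: ler_sum => j.
rewrite in_fset_set// inE => Bj.
by rewrite mulrAC mulrA ler_wpM2l ?fg// mulr_ge0 ?w0 ?v0.
Qed.

Section Spheres.
Variables (R : realType) (G : weighted_graph R).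
Hypothesis conn : connected G.
Implicit Types (x y o : G) (r : nat).

Lemma joined_by_dist x y : joined_by (dist x y) x y.
Proof.
rewrite /dist; case: pselect => [xy|/(_ (conn x y))//].
by case: ex_minnP => n /asboolP.
Qed.

Lemma dist_le n x y : joined_by n x y -> (dist x y <= n)%N.
Proof.
move=> xyn; rewrite /dist; case: pselect => [xy|nxy].
  by case: ex_minnP => k _; apply; apply/asboolP.
by case: nxy; exists n.
Qed.

Lemma dist_eq0 x y : (dist x y == 0%N) = (x == y).
Proof.
apply/eqP/eqP => [d0|->].
  by have := joined_by_dist x y; rewrite d0 => -[[|? ?] [_ ? ?]].
by apply/eqP; rewrite -leqn0; apply: dist_le; exists [::].
Qed.

Lemma sphere0 o : sphere o 0 = [set o].
Proof. by apply/seteqP; split=> x /=; [move/eqP|move=> ->; apply/eqP]; rewrite dist_eq0 => // /eqP. Qed.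

(** The witness is the second vertex of a shortest path from [x] to [o]: the rest of that path
    bounds its distance above by [r], and prepending [x] to a shortest path bounds it below. *)
Lemma sphereS_adj o r x : sphere o r.+1 x -> exists2 y, sphere o r y & adj x y.
Proof.
rewrite /sphere/= => dx; have := joined_by_dist x o; rewrite dx.
move=> [[|y p] [//= /andP[xy yp] lyp [sp]]]; exists y => //=.
have [q [yq lq sq]] := joined_by_dist y o.
apply/eqP; rewrite eqn_leq; apply/andP; split; first by apply: dist_le; exists p.
rewrite -ltnS -dx; apply: dist_le; exists (y :: q).
by split; rewrite /= ?xy ?sq.
Qed.

Lemma finite_sphere o r : locally_finite G -> finite_set (sphere o r).
Proof.
move=> lf; elim: r => [|r IH]; first by rewrite sphere0; exact: finite_set1.
have : finite_set (\bigcup_(y in sphere o r) [set x | adj y x]).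
  by apply: bigcup_finite => // y _; exact: lf.
apply: sub_finite_set => x /sphereS_adj[y yr xy].
by exists y => //=; rewrite /adj weight_sym.
Qed.

Definition edge_mass o r : R :=
  \sum_(x \in sphere o r) \sum_(y \in sphere o r.+1) weight x y.

Definition sphere_mass o r : R := \sum_(x \in sphere o r) vmeasure x.

Lemma sphere_mass_ge0 o r : 0 <= sphere_mass o r.
Proof. by apply: fsumr_ge0 => x _; exact/ltW/vmeasure_gt0. Qed.

Lemma edge_mass_outer o r :
  edge_mass o r = \sum_(x \in sphere o r) vmeasure x * outer_curvature o x.
Proof.
apply: eq_fsbigr => x; rewrite inE => xr.
by rewrite /outer_curvature xr mulVKf// gt_eqF// vmeasure_gt0.
Qed.

Hypothesis lf : locally_finite G.

Lemma edge_mass_inner o r :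
  edge_mass o r = \sum_(y \in sphere o r.+1) vmeasure y * inner_curvature o y.
Proof.
rewrite /edge_mass exchange_fsbig; [|exact: finite_sphere..].
apply: eq_fsbigr => y; rewrite inE => yr.
(* The distance [r.+1] is nonzero, so [y] is not the root and the default value 0 is avoided. *)
rewrite /inner_curvature -dist_eq0 yr/= mulVKf ?gt_eqF ?vmeasure_gt0//.
by apply: eq_fsbigr => x _; rewrite weight_sym.
Qed.

Lemma measure_of_sphere o r : measure_of (sphere o r) = (sphere_mass o r)%:E.
Proof.
have fin := finite_sphere o r lf.
by rewrite /measure_of esum_fset ?fsumEFin// => x _; rewrite lee_fin ltW ?vmeasure_gt0.
Qed.

Lemma sphere_mass_gt0 o r x : sphere o r x -> 0 < sphere_mass o r.
Proof.
move=> xr; rewrite lt0r sphere_mass_ge0 andbT; apply/eqP => m0.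
have := vmeasure_gt0 x; rewrite (pfsumr_eq0 _ _ m0) ?ltxx//.
  exact: finite_sphere.
by move=> y _; exact/ltW/vmeasure_gt0.
Qed.

Lemma edge_mass_gt0 o r x : sphere o r.+1 x -> 0 < edge_mass o r.
Proof.
move=> xr; have [y yr xy] := sphereS_adj xr.
have w0 z : 0 <= \sum_(t \in sphere o r.+1) weight z t.
  by apply: fsumr_ge0 => t _; exact: weight_ge0.
rewrite lt0r; apply/andP; split; last by apply: fsumr_ge0 => z _; exact: w0.
(* A zero total would force every weight between the two spheres to vanish, including that of the
   edge from [y] to [x]. *)
apply/eqP => /(pfsumr_eq0 (finite_sphere o r lf) (fun z _ => w0 z))/(_ y yr).
move/(pfsumr_eq0 (finite_sphere o r.+1 lf) (fun z _ => weight_ge0 y z)).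
by move=> /(_ x xr) yx0; move: xy; rewrite /adj weight_sym yx0 ltxx.
Qed.

End Spheres.

Local Close Scope classical_set_scope.

(* The hypothesis [vmeasure o2 <= vmeasure o1] is the normalization of the
   roots, i.e. exactly the case r = 0 of the conclusion, which does not follow
   from the curvature comparison: curvatures are invariant under scaling
   weight and vmeasure by a common factor. *)
Theorem theorem1 (R : realType) (G1 G2 : weighted_graph R) (o1 : G1) (o2 : G2)
  (conn1 : connected G1) (lf1 : locally_finite G1)
  (conn2 : connected G2) (lf2 : locally_finite G2)
  (root_le : vmeasure o2 <= vmeasure o1)
  (outer_ge : forall (r : nat) (x1 : G1) (x2 : G2),
     sphere o1 r x1 -> sphere o2 r x2 ->
     outer_curvature o2 x2 <= outer_curvature o1 x1)
  (inner_le : forall (r : nat) (x1 : G1) (x2 : G2),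
     sphere o1 r x1 -> sphere o2 r x2 ->
     inner_curvature o1 x1 <= inner_curvature o2 x2) :
  forall r : nat,
    (measure_of (sphere o2 r) <= measure_of (sphere o1 r))%E.
Proof.
have fin1 r := finite_sphere conn1 o1 r lf1.
have fin2 r := finite_sphere conn2 o2 r lf2.
have m1 (x : G1) : 0 <= vmeasure x by exact/ltW/vmeasure_gt0.
have m2 (x : G2) : 0 <= vmeasure x by exact/ltW/vmeasure_gt0.
move=> r; rewrite !measure_of_sphere// lee_fin.
elim: r => [|r IH].
  by rewrite /sphere_mass !sphere0// !fsbig_set1.
(* An empty sphere has mass 0; otherwise a vertex in it makes [edge_mass o2 r] and
   [sphere_mass o2 r] positive. *)
have [[x xr]|none] := pselect (exists x, sphere o2 r.+1 x); last first.
  have -> : sphere_mass o2 r.+1 = 0.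
    by apply: fsbig1 => x xr; case: none; exists x.
  exact: sphere_mass_ge0.
have e2_gt0 := edge_mass_gt0 conn2 lf2 xr.
have [y yr _] := sphereS_adj conn2 xr.
have M2_gt0 := sphere_mass_gt0 conn2 lf2 yr.
have outer : edge_mass o2 r * sphere_mass o1 r <=
             edge_mass o1 r * sphere_mass o2 r.
  rewrite !edge_mass_outer//; apply: ler_fsum_cross => // x2 x1 x2r x1r.
  exact: outer_ge x1r x2r.
have inner : edge_mass o1 r * sphere_mass o2 r.+1 <=
             edge_mass o2 r * sphere_mass o1 r.+1.
  rewrite !edge_mass_inner//; apply: ler_fsum_cross => // x1 x2 x1r x2r.
  exact: inner_le x1r x2r.
have ratio : sphere_mass o1 r * sphere_mass o2 r.+1 <=
             sphere_mass o1 r.+1 * sphere_mass o2 r.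
  (* After scaling by [edge_mass o2 r], the middle term of the chain is the product of
     [edge_mass o1 r] with both sphere masses of [G2]. *)
  rewrite -(ler_pM2l e2_gt0) !mulrA.
  apply: le_trans (ler_wpM2r (ltW M2_gt0) inner).
  by rewrite [leRHS]mulrAC ler_wpM2r// sphere_mass_ge0.
(* The factor [sphere_mass o1 r], positive by [IH], is cancelled; [IH] also bounds the right side of
   [ratio]. *)
rewrite -(ler_pM2l (lt_le_trans M2_gt0 IH)); apply: le_trans ratio _.
by rewrite mulrC ler_wpM2r// sphere_mass_ge0.
Qed.
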